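(* For every integer $n\ge 1$, there is a bijection between the set of isomorphism classes of unbalanced bipartite posets on $n$ points and the set of isomorphism classes of bipartite posets on $t$ points, where $t$ ranges over $0\le t\le n-1$.
   Context: A bipartite poset is a finite poset of height at most one (no three elements $x\prec y\prec z$); here the empty poset is allowed (for $t=0$). An element $v$ has height 1 if there is $u$ with $u\prec v$, and height 0 otherwise. A height-0 element is a full support point if it is comparable to every height-1 element. A bipartite poset is unbalanced if it contains a full support point and balanced otherwise. Posets are considered up to isomorphism. *)

(* Defs.v *)
From HB Require Import structures.
From mathcomp Require Import all_boot all_order.

Set Implicit Arguments.
Unset Strict Implicit.
Unset Printing Implicit Defensive.

Import Order.Theory.
Local Open Scope order_scope.

Section Bipartite.
Variables (d : Order.disp_t) (T : finPOrderType d).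

Definition bipartite : bool :=
  ~~ [exists x : T, exists y : T, exists z : T, (x < y) && (y < z)].

Definition height1 (v : T) : bool := [exists u : T, u < v].

Definition height0 (v : T) : bool := ~~ height1 v.

(* When there is no height-1 element, every point is a full support point. *)
Definition full_support_point (v : T) : bool :=
  height0 v && [forall w : T, height1 w ==> (v >=< w)].

Definition unbalanced : bool :=
  bipartite && [exists v : T, full_support_point v].

End Bipartite.

Arguments bipartite {d} T.
Arguments unbalanced {d} T.

Definition order_iso (d1 d2 : Order.disp_t)
    (T1 : finPOrderType d1) (T2 : finPOrderType d2) : bool :=
  [exists f : {ffun T1 -> T2}, exists g : {ffun T2 -> T1},
    [&& [forall x, g (f x) == x], [forall y, f (g y) == y] &
        [forall x, forall y, (f x <= f y) == (x <= y)]]].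

Lemma order_isoP (d1 d2 : Order.disp_t)
    (T1 : finPOrderType d1) (T2 : finPOrderType d2) :
  reflect (exists2 f : T1 -> T2, bijective f & {mono f : x y / x <= y})
          (order_iso T1 T2).
Proof.
apply: (iffP existsP) => [[f /existsP[g /and3P[/forallP fK /forallP gK]]]|].
  move=> /forallP fm; exists f; last first.
    by move=> x y; apply/eqP; move: (fm x) => /forallP.
  by exists g => x; apply/eqP.
case=> f [g fK gK] fm; exists (finfun f); apply/existsP; exists (finfun g).
apply/and3P; split; apply/forallP => x; rewrite ?ffunE ?fK ?gK //.
by apply/forallP => y; rewrite !ffunE fm.
Qed.

Definition is_order (n : nat) (r : {ffun 'I_n * 'I_n -> bool}) : bool :=
  [&& [forall x, r (x, x)],
      [forall x, forall y, r (x, y) && r (y, x) ==> (x == y)] &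
      [forall x, forall y, forall z, r (x, y) && r (y, z) ==> r (x, z)]].

Record poset (n : nat) := Poset {
  poset_rel :> {ffun 'I_n * 'I_n -> bool};
  poset_relP : is_order poset_rel }.

HB.instance Definition _ n := [isSub for @poset_rel n].
HB.instance Definition _ n := [Finite of poset n by <:].

(* A copy of 'I_n carrying the order P instead of the numerical one. *)
Definition points (n : nat) (P : poset n) : Type := 'I_n.

Fact poset_display : Order.disp_t. Proof. exact: (Order.Disp tt tt). Qed.

Section Points.
Variables (n : nat) (P : poset n).

Definition points_le : rel (points P) := fun x y => P (x, y).

Lemma points_le_refl : reflexive points_le.
Proof. by case/and3P: (poset_relP P) => /forallP. Qed.

Lemma points_le_anti : antisymmetric points_le.
Proof.
case/and3P: (poset_relP P) => _ /forallP h _ x y xy.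
by have /forallP/(_ y)/implyP/(_ xy)/eqP := h x.
Qed.

Lemma points_le_trans : transitive points_le.
Proof.
case/and3P: (poset_relP P) => _ _ /forallP h y x z xy yz.
by have /forallP/(_ y)/forallP/(_ z)/implyP := h x; apply; apply/andP.
Qed.

HB.instance Definition _ := Finite.copy (points P) 'I_n.
HB.instance Definition _ := Order.Le_isPOrder.Build
  poset_display (points P) points_le_refl points_le_anti points_le_trans.

End Points.

Definition poset_iso (n : nat) : rel (poset n) :=
  fun P Q => order_iso (points P) (points Q).

Lemma poset_iso_equiv (n : nat) : equivalence_rel (@poset_iso n).
Proof.
have sym (P Q : poset n) : poset_iso P Q -> poset_iso Q P.
  case/order_isoP=> f [g fK gK] fm; apply/order_isoP.
  by exists g; [exists f | move=> x y; rewrite -fm !gK].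
have tr (P Q S : poset n) : poset_iso P Q -> poset_iso Q S -> poset_iso P S.
  case/order_isoP=> f bf fm /order_isoP[g bg gm]; apply/order_isoP.
  by exists (g \o f); [exact: bij_comp | move=> x y /=; rewrite gm fm].
move=> P Q S; split; first by apply/order_isoP; exists id => //; exists id.
by move=> PQ; apply/idP/idP; apply: tr => //; apply: sym.
Qed.

Lemma poset_complete (d : Order.disp_t) (T : finPOrderType d) (n : nat) :
  #|T| = n -> exists P : poset n, order_iso T (points P).
Proof.
move=> <-; pose r := [ffun p : 'I_#|T| * 'I_#|T| =>
  enum_val p.1 <= enum_val p.2 :> T].
have rP : is_order r.
  apply/and3P; split; apply/forallP => x; rewrite ?ffunE //=.
    apply/forallP => y; rewrite !ffunE /=; apply/implyP => /le_anti.
    by move/enum_val_inj => ->.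
  apply/forallP => y; apply/forallP => z; rewrite !ffunE /=.
  by apply/implyP => /andP[]; apply: le_trans.
exists (Poset rP); apply/order_isoP; exists (fun x => enum_rank x).
  by exists (fun i => enum_val i); [exact: enum_rankK | exact: enum_valK].
by move=> x y; rewrite {1}/Order.le /= /points_le /= ffunE /= !enum_rankK.
Qed.

(* Isomorphism classes as cells of the partition of the labelled posets on
   'I_n by isomorphism; poset_complete shows that every n-point poset
   is represented. *)
Definition bipartite_classes (n : nat) : {set {set poset n}} :=
  equivalence_partition (@poset_iso n) [set P | bipartite (points P)].

Definition unbalanced_classes (n : nat) : {set {set poset n}} :=
  equivalence_partition (@poset_iso n) [set P | unbalanced (points P)].

(* Main.v *)
Require Import Defs.
From HB Require Import structures.
From mathcomp Require Import all_boot all_order.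

(** In an unbalanced poset fix a full support point [v], delete it together
    with the points whose only strict lower bound is [v]; what remains is a
    bipartite poset [P] on [t < n] points.  Conversely [P] determines the poset
    up to isomorphism: put a new point below all height-1 elements of [P] and
    below [n - 1 - t] further new points ([extension]).  The choice of [v]
    is immaterial because any two full support points are exchanged by an
    automorphism fixing all other points. *)

Set Implicit Arguments.
Unset Strict Implicit.
Unset Printing Implicit Defensive.

Import Order.Theory.
Local Open Scope order_scope.

(** * Invariance under order isomorphisms *)

Section OrderIso.
Variables (d1 d2 d3 : Order.disp_t) (T1 : finPOrderType d1)
  (T2 : finPOrderType d2) (T3 : finPOrderType d3).

Lemma order_iso_refl : order_iso T1 T1.
Proof. by apply/order_isoP; exists id => //; exists id. Qed.

Lemma order_iso_sym : order_iso T1 T2 -> order_iso T2 T1.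
Proof.
case/order_isoP=> f [g fK gK] fm; apply/order_isoP.
by exists g; [exists f | move=> x y; rewrite -fm !gK].
Qed.

Lemma order_iso_trans : order_iso T1 T2 -> order_iso T2 T3 -> order_iso T1 T3.
Proof.
case/order_isoP=> f bf fm /order_isoP[g bg gm]; apply/order_isoP.
by exists (g \o f); [exact: bij_comp | move=> x y /=; rewrite gm fm].
Qed.

Lemma order_iso_card : order_iso T1 T2 -> #|T1| = #|T2|.
Proof. by case/order_isoP=> f /bij_eq_card. Qed.

Variable f : T1 -> T2.
Hypotheses (f_bij : bijective f) (f_mono : {mono f : x y / x <= y}).

Lemma height1_mono x : height1 (f x) = height1 x.
Proof.
have fl := leW_mono f_mono; case: f_bij => g fK gK.
apply/existsP/existsP => -[u ux]; last by exists (f u); rewrite fl.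
by exists (g u); rewrite -fl gK.
Qed.

Lemma full_support_point_mono x :
  full_support_point (f x) = full_support_point x.
Proof.
case: f_bij => g fK gK; rewrite /full_support_point /height0 height1_mono.
congr (_ && _); apply/forallP/forallP => h w.
  by have := h (f w); rewrite height1_mono /Order.comparable !f_mono.
by rewrite -(gK w) height1_mono /Order.comparable !f_mono; apply: h.
Qed.

End OrderIso.

Lemma bipartiteP d (T : finPOrderType d) :
  reflect (forall x y z : T, x < y -> y < z -> False) (bipartite T).
Proof.
apply: (iffP negP) => h.
  move=> x y z xy yz; apply: h; apply/existsP; exists x.
  by apply/existsP; exists y; apply/existsP; exists z; rewrite xy.
by case/existsP=> x /existsP[y /existsP[z /andP[]]]; apply: h.
Qed.

Lemma bipartite_embedding d1 d2 (T1 : finPOrderType d1) (T2 : finPOrderType d2)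
    (f : T1 -> T2) :
  {mono f : x y / x <= y} -> bipartite T2 -> bipartite T1.
Proof.
move=> /leW_mono fl /bipartiteP h; apply/bipartiteP => x y z xy yz.
by apply: (h (f x) (f y) (f z)); rewrite fl.
Qed.

Lemma unbalanced_iso d1 d2 (T1 : finPOrderType d1) (T2 : finPOrderType d2) :
  order_iso T1 T2 -> unbalanced T1 -> unbalanced T2.
Proof.
move=> i12; case/order_isoP: (order_iso_sym i12) => g _ gm.
case/order_isoP: i12 => f bf fm /andP[b1 /existsP[v fv]].
apply/andP; split; first exact: bipartite_embedding gm b1.
by apply/existsP; exists (f v); rewrite full_support_point_mono.
Qed.

(** * Full support points and their exchange *)

Section FullSupportPoint.
Variables (d : Order.disp_t) (T : finPOrderType d) (v : T).
Hypothesis v_full : full_support_point v.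

Lemma le_full x : (x <= v) = (x == v).
Proof.
case/andP: v_full => /negP v0 _; rewrite le_eqVlt; case: eqP => //= _.
by apply/negP => xv; apply: v0; apply/existsP; exists x.
Qed.

(** Minimality of [v] turns comparability into [v < y]. The right-hand side does not mention [v], so
    all full support points have the same strict upper bounds. *)
Lemma full_lt y : (v < y) = height1 y.
Proof.
apply/idP/idP => [vy|y1]; first by apply/existsP; exists v.
case/andP: v_full => /negP v0 /forallP/(_ y)/implyP/(_ y1).
rewrite /Order.comparable le_full => /orP[vy|/eqP yv]; last first.
  by case: v0; rewrite -yv.
by rewrite lt_neqAle vy andbT; apply/eqP => vy'; apply: v0; rewrite vy'.
Qed.

Lemma full_le y : (v <= y) = (y == v) || height1 y.
Proof. by rewrite le_eqVlt full_lt eq_sym. Qed.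

Lemma full_height0 : height1 v = false.
Proof. by case/andP: v_full => /negbTE. Qed.

End FullSupportPoint.

(** The condition at [y = v] forces [v < x]. Removing [v] alone would turn such an [x] into a
    minimal element, so these points are removed with it. *)
Definition only_above d (T : finPOrderType d) (v x : T) : bool :=
  [forall y, (y < x) == (y == v)].

(** The transposition of [v] and [w] works: both are minimal and have the same strict upper
    bounds. *)
Lemma swap_full d (T : finPOrderType d) (v w : T) :
  full_support_point v -> full_support_point w ->
  exists2 f : T -> T, bijective f & {mono f : x y / x <= y} /\ f v = w.
Proof.
move=> fv fw; pose f x := if x == v then w else if x == w then v else x.
have fE x : x != v -> x != w -> f x = x by rewrite /f => /negbTE-> /negbTE->.
have fv' : f v = w by rewrite /f eqxx.
have fw' : f w = v by rewrite /f eqxx; case: eqP.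
have fK : involutive f.
  move=> x; have [->|xv] := eqVneq x v; first by rewrite fv' fw'.
  by have [->|xw] := eqVneq x w; [rewrite fw' fv' | rewrite !fE].
have fi := inv_inj fK.
exists f; [exact: inv_bij | split=> // x y].
(* What lies above a full support point depends only on heights, and [f] preserves height because
   the two points it moves both have height 0. *)
have key a b y' : full_support_point a -> full_support_point b ->
    f a = b -> (f a <= f y') = (a <= y').
  move=> fa fb ab; rewrite {1}ab (full_le fa) (full_le fb) -ab (inj_eq fi).
  congr orb; have [->|yv] := eqVneq y' v.
    by rewrite fv' !full_height0.
  by have [->|yw] := eqVneq y' w; [rewrite fw' !full_height0 | rewrite fE].
have [->|xv] := eqVneq x v; first exact: key fv fw fv'.
have [->|xw] := eqVneq x w; first exact: key fw fv fw'.
rewrite (fE x) //; have [->|yv] := eqVneq y v.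
  by rewrite fv' !le_full // (negbTE xv) (negbTE xw).
have [->|yw] := eqVneq y w; last by rewrite fE.
by rewrite fw' !le_full // (negbTE xv) (negbTE xw).
Qed.

(** * The extension of a poset by a full support point *)

Definition extension d (T : finPOrderType d) (K : finType) : Type :=
  option (T + K).

Section Extension.
Variables (d : Order.disp_t) (T : finPOrderType d) (K : finType).
Notation E := (extension T K).

Definition extension_le : rel E := fun x y =>
  match x, y with
  | None, None => true
  | None, Some (inl p) => height1 p
  | None, Some (inr _) => true
  | Some (inl p), Some (inl q) => p <= q
  | Some (inr i), Some (inr j) => i == j
  | _, _ => false
  end.

Lemma extension_le_refl : reflexive extension_le.
Proof. by case=> [[p|i]|] /=. Qed.

Lemma extension_le_anti : antisymmetric extension_le.
Proof.
move=> [[p|i]|] [[q|j]|] //=; rewrite ?andbF //.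
  by move/le_anti->.
by case/andP=> /eqP->.
Qed.

Lemma extension_le_trans : transitive extension_le.
Proof.
move=> [[q|j]|] [[p|i]|] [[r|k]|] //=.
- exact: le_trans.
(* The apex is below [q], which is below [r]: having height 1 is inherited upwards. *)
- move=> /existsP[u uq] qr; apply/existsP; exists u; exact: lt_le_trans qr.
- by move=> /eqP->.
Qed.

HB.instance Definition _ := Finite.copy E (option (T + K)).
HB.instance Definition _ := Order.Le_isPOrder.Build
  d E extension_le_refl extension_le_anti extension_le_trans.

Lemma extension_leE (x y : E) : (x <= y) = extension_le x y.
Proof. by []. Qed.

Definition apex : E := None.
Definition old_point (p : T) : E := Some (inl p).
Definition new_point (i : K) : E := Some (inr i).

Lemma old_point_mono : {mono old_point : p q / p <= q}.
Proof. by []. Qed.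

(** The apex is placed only below old points that already have height 1, so no old point changes
    height. *)
Lemma height1_old p : height1 (old_point p) = height1 p.
Proof.
apply/existsP/existsP => [[[[q|i]|]]|[q qp]].
- by rewrite (leW_mono old_point_mono) => qp; exists q.
- by rewrite lt_def extension_leE andbF.
- by rewrite lt_def extension_leE /= => /existsP.
- by exists (old_point q); rewrite (leW_mono old_point_mono).
Qed.

Lemma apex_full : full_support_point apex.
Proof.
apply/andP; split.
  by apply/existsP => -[[[p|i]|]]; rewrite lt_def extension_leE /= ?andbF.
apply/forallP => -[[p|i]|];
  rewrite /Order.comparable ?extension_leE /= ?implybT //.
by rewrite -/(old_point p) height1_old orbF implybb.
Qed.

(** The middle of a chain [x < y < z] has height 1, so it is not the apex. If it is old, the chain
    yields one in [T]; if it is new, nothing lies strictly above it. *)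
Lemma bipartite_extension : bipartite T -> bipartite E.
Proof.
move/bipartiteP => bT; apply/bipartiteP => x y z xy yz.
have y1 : height1 y by apply/existsP; exists x.
move: yz y1 {xy}; case: y => [[p|i]|]; last by rewrite (full_height0 apex_full).
  rewrite -/(old_point p) height1_old => pz /existsP[q qp].
  case: z pz => [[r|j]|]; last 2 first.
  - by rewrite lt_def extension_leE andbF.
  - by rewrite lt_def extension_leE andbF.
  by rewrite (leW_mono old_point_mono); apply: bT qp.
case: z => [[r|j]|]; rewrite lt_def extension_leE /= ?andbF //.
by case/andP=> /negP h /eqP e; case: h; rewrite e.
Qed.

Lemma unbalanced_extension : bipartite T -> unbalanced E.
Proof.
move=> bT; apply/andP; split; first exact: bipartite_extension.
by apply/existsP; exists apex; apply: apex_full.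
Qed.

Lemma card_extension : #|{: E}| = (#|T| + #|K|).+1.
Proof. by rewrite card_option card_sum. Qed.

Lemma only_above_apex_new i : only_above apex (new_point i).
Proof.
apply/forallP => -[[p|j]|]; rewrite lt_def extension_leE //=.
by have [->|_] := eqVneq j i; rewrite ?eqxx ?andbF.
Qed.

(** An old point above the apex has height 1 in [T], hence also a strict lower bound among the old
    points. *)
Lemma only_above_apex_old p : only_above apex (old_point p) = false.
Proof.
apply/negP => /forallP h.
have /existsP[q qp] : height1 p.
  by rewrite -height1_old; apply/existsP; exists apex; rewrite (eqP (h apex)).
by have := h (old_point q); rewrite (leW_mono old_point_mono) qp.
Qed.

(** This describes the old points by the order and the apex alone, so isomorphisms matching the
    apexes also match the old points. *)
Lemma old_pointP (x : E) :
  reflect (exists p, x = old_point p) ((x != apex) && ~~ only_above apex x).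
Proof.
apply: (iffP andP) => [[]|[p ->]]; last by rewrite only_above_apex_old.
case: x => [[p|i]|] // _; first by exists p.
by rewrite only_above_apex_new.
Qed.

End Extension.

(** * Isomorphisms between extensions *)

Lemma only_above_mono d1 d2 (T1 : finPOrderType d1) (T2 : finPOrderType d2)
    (f : T1 -> T2) (v x : T1) :
  bijective f -> {mono f : x y / x <= y} ->
  only_above (f v) (f x) = only_above v x.
Proof.
move=> bf fm; have fl := leW_mono fm; have fi := bij_inj bf.
case: bf => g fK gK; apply/forallP/forallP => h y.
  by rewrite -fl -(inj_eq fi).
by rewrite -(gK y) fl (inj_eq fi).
Qed.

Lemma equipotent_bij (K1 K2 : finType) :
  #|K1| = #|K2| -> exists f : K1 -> K2, bijective f.
Proof.
move=> e; exists (fun x => enum_val (cast_ord e (enum_rank x))).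
exists (fun y => enum_val (cast_ord (esym e) (enum_rank y))) => x;
  by rewrite enum_valK ?cast_ordK ?cast_ordKV enum_rankK.
Qed.

Lemma extension_iso d1 d2 (T1 : finPOrderType d1) (T2 : finPOrderType d2)
    (K1 K2 : finType) :
  order_iso T1 T2 -> #|K1| = #|K2| ->
  order_iso (extension T1 K1) (extension T2 K2).
Proof.
case/order_isoP=> f bf fm /equipotent_bij[h bh].
have hi := bij_inj bh; have f1 := height1_mono bf fm.
case: bf bh => f' fK f'K [h' hK h'K]; apply/order_isoP.
exists (fun x => match x with
  | None => apex T2 K2
  | Some (inl p) => old_point K2 (f p)
  | Some (inr i) => new_point T2 (h i) end).
  exists (fun x => match x with
    | None => apex T1 K1
    | Some (inl p) => old_point K1 (f' p)
    | Some (inr i) => new_point T1 (h' i) end);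
  by move=> [[p|i]|] //=; rewrite ?fK ?hK ?f'K ?h'K.
by move=> [[p|i]|] [[q|j]|]; rewrite !extension_leE //= (inj_eq hi).
Qed.

Lemma extension_iso_inv d1 d2 (T1 : finPOrderType d1) (T2 : finPOrderType d2)
    (K1 K2 : finType) :
  order_iso (extension T1 K1) (extension T2 K2) -> order_iso T1 T2.
Proof.
case/order_isoP=> h0 bh0 hm0.
have full0 : full_support_point (h0 (apex T1 K1)).
  by rewrite full_support_point_mono //; apply: apex_full.
(* The given isomorphism may send the apex to another full support point; a swap in the target
   corrects this. *)
have [s bs [sm sv]] := swap_full full0 (apex_full T2 K2).
pose h := s \o h0.
have bh : bijective h by apply: bij_comp.
have hm : {mono h : x y / x <= y} by move=> x y /=; rewrite sm hm0.
have hv : h (apex T1 K1) = apex T2 K2 by rewrite /h /= sv.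
have hi := bij_inj bh.
have core x : (h x != apex T2 K2) && ~~ only_above (apex T2 K2) (h x) =
    (x != apex T1 K1) && ~~ only_above (apex T1 K1) x.
  by rewrite -hv (inj_eq hi) only_above_mono.
have ex p : exists q, h (old_point K1 p) = old_point K2 q.
  by apply/old_pointP; rewrite core; apply/old_pointP; exists p.
have [g gE] := fin_all_exists ex.
have gm : {mono g : x y / x <= y}.
  by move=> x y; rewrite -(old_point_mono K2) -!gE hm old_point_mono.
case: (bh) => h' hK h'K.
have ex' q : exists p, h' (old_point K2 q) = old_point K1 p.
  by apply/old_pointP; rewrite -core h'K; apply/old_pointP; exists q.
have [g' g'E] := fin_all_exists ex'.
apply/order_isoP; exists g => //; exists g' => x.
  by have := hK (old_point K1 x); rewrite gE g'E => -[].
by have := h'K (old_point K2 x); rewrite g'E gE => -[].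
Qed.

(** * Decomposition of an unbalanced poset *)

Definition subposet d (T : finPOrderType d) (A : pred T) : Type :=
  {x : T | A x}.

Section Subposet.
Variables (d : Order.disp_t) (T : finPOrderType d) (A : pred T).
HB.instance Definition _ := SubType.copy (subposet A) {x : T | A x}.
HB.instance Definition _ := Finite.copy (subposet A) {x : T | A x}.
HB.instance Definition _ := [SubChoice_isSubPOrder of subposet A by <: with d].
End Subposet.

Lemma unbalanced_decomposition d (T : finPOrderType d) :
  unbalanced T ->
  exists A B : pred T, bipartite (subposet A) /\
    order_iso (extension (subposet A) {x | B x}) T.
Proof.
case/andP=> bT /existsP[v fv]; have /bipartiteP bTP := bT.
pose B := [pred x | only_above v x]; pose A := [pred x | (x != v) && ~~ B x].
have AE x : A x = (x != v) && ~~ B x by [].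
exists A, B; split.
  exact: (@bipartite_embedding _ _ _ _ (val : subposet A -> T)).
have vB x : B x -> x != v.
  by move=> /forallP/(_ v); rewrite eqxx => /eqP/gt_eqF->.
have ltB x y : B x -> (y < x) = (y == v) by move=> /forallP/(_ y)/eqP.
pose f (x : extension (subposet A) {x | B x}) : T :=
  match x with None => v | Some (inl p) => val p | Some (inr i) => val i end.
have vA x : A x -> x != v by rewrite AE => /andP[].
have AB x y : A x -> B y -> x != y.
  by rewrite AE => /andP[_ xB] yB; apply: contraNneq xB => ->.
have fi : injective f.
  move=> [[[p pA]|[i iB]]|] [[[q qA]|[j jB]]|] //= e.
  - by congr (Some (inl _)); apply: val_inj.
  - by case/eqP: (AB _ _ pA jB).
  - by case/eqP: (vA _ pA).
  - by case/eqP: (AB _ _ qA iB).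
  - by congr (Some (inr _)); apply: val_inj.
  - by case/eqP: (vB _ iB).
  - by case/eqP: (vA _ qA).
  - by case/eqP: (vB _ jB).
apply/order_isoP; exists f.
  (* Surjectivity: every point is [v], or lies in [B], or else lies in [A]. *)
  apply: (inj_card_bij fi); rewrite -(card_codom fi); apply: subset_leq_card.
  apply/subsetP => x _; apply/codomP.
  have [->|xv] := eqVneq x v; first by exists (apex _ _).
  have [xB|xB] := boolP (B x).
    by exists (new_point _ (exist _ x xB : {x | B x})).
  have xA : A x by rewrite AE xv.
  by exists (old_point _ (exist _ x xA : subposet A)).
move=> [[[p pA]|[i iB]]|] [[[q qA]|[j jB]]|] //=; rewrite extension_leE /=.
- by rewrite le_eqVlt ltB // (negbTE (AB _ _ pA jB)) (negbTE (vA _ pA)).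
- by rewrite le_full // (negbTE (vA _ pA)).
(* A point of [B] is above [v], so nothing can lie strictly above it in a bipartite poset. *)
- rewrite le_eqVlt eq_sym (negbTE (AB _ _ qA iB)); apply/negP => iq.
  by apply: (bTP v i q) => //; rewrite ltB.
- by rewrite le_eqVlt ltB // (negbTE (vB _ iB)) orbF.
- by rewrite le_full // (negbTE (vB _ iB)).
(* The decisive case: [v] is below [q] exactly when [q] has height 1 inside [A]. Since [q] is not in
   [B], being above [v] gives it a second strict lower bound [y], and [y] in [B] would create the
   chain [v < y < q]. *)
- have [qv qB] := andP qA; rewrite full_le // (negbTE qv) /=.
  apply/idP/existsP => [q1|[[y yA] yq]]; last by apply/existsP; exists y.
  have vq : v < q by rewrite full_lt.
  have /existsP[y] : ~~ [forall y, (y < q) ==> (y == v)].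
    apply: contra qB => /forallP h; apply/forallP => y.
    by apply/eqP; apply/idP/idP=> [/(implyP (h y))|/eqP->].
  rewrite negb_imply => /andP[yq yv].
  have yA : A y.
    rewrite AE yv /=; apply/negP => yB.
    by apply: (bTP v y q) => //; rewrite ltB.
  by exists (exist _ y yA : subposet A).
- by rewrite ltW // ltB.
- by rewrite lexx.
Qed.

(** * Isomorphism classes and the bijection between them *)

Section IsoClasses.
Variables (n : nat) (D : {set poset n}) (C : {set poset n}).
Hypothesis DC : C \in equivalence_partition (@poset_iso n) D.

Lemma iso_class_ex : exists P, P \in C.
Proof.
case/imsetP: DC => P PD ->; exists P.
by rewrite inE PD; apply: order_iso_refl.
Qed.

Lemma iso_class_sub P : P \in C -> P \in D.
Proof. by case/imsetP: DC => Q _ ->; rewrite inE => /andP[]. Qed.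

Lemma iso_class_iso P Q :
  P \in C -> Q \in C -> order_iso (points P) (points Q).
Proof.
case/imsetP: DC => S _ ->; rewrite !inE => /andP[_ SP] /andP[_ SQ].
exact: order_iso_trans (order_iso_sym SP) SQ.
Qed.

Lemma mem_iso_class P Q :
  P \in C -> Q \in D -> order_iso (points P) (points Q) -> Q \in C.
Proof.
case/imsetP: DC => S _ ->; rewrite !inE => /andP[_ SP] -> PQ.
exact: order_iso_trans SP PQ.
Qed.

End IsoClasses.

Lemma iso_class_eq n (D C C' : {set poset n}) P P' :
  C \in equivalence_partition (@poset_iso n) D ->
  C' \in equivalence_partition (@poset_iso n) D ->
  P \in C -> P' \in C' -> order_iso (points P) (points P') -> C = C'.
Proof.
move=> CD CD' PC PC' iP; apply/setP => Q; apply/idP/idP => QC.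
  apply: (mem_iso_class CD' PC'); first exact: iso_class_sub QC.
  exact: order_iso_trans (order_iso_sym iP) (iso_class_iso CD PC QC).
apply: (mem_iso_class CD PC); first exact: iso_class_sub QC.
exact: order_iso_trans iP (iso_class_iso CD' PC' QC).
Qed.

Lemma iso_classP n (D : {set poset n}) P : P \in D ->
  exists2 C, C \in equivalence_partition (@poset_iso n) D & P \in C.
Proof.
move=> PD; exists [set Q in D | poset_iso P Q]; first exact: imset_f.
by rewrite inE PD; apply: order_iso_refl.
Qed.

(** Choosing values in both directions gives two maps, and uniqueness on each side makes them
    mutually inverse. Classes can thus be related through arbitrary representatives. *)
Lemma bijective_of_rel (X Y : finType) (R : X -> Y -> Prop) :
  (forall x, exists y, R x y) -> (forall y, exists x, R x y) ->
  (forall x y y', R x y -> R x y' -> y = y') ->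
  (forall x x' y, R x y -> R x' y -> x = x') ->
  exists f : X -> Y, bijective f.
Proof.
move=> /fin_all_exists[f fR] /fin_all_exists[g gR] Rf Ri.
by exists f, g => [x|y]; [apply: Ri (fR x) | apply: Rf (gR y)].
Qed.

Theorem theorem4p4 (n : nat) (hn : (1 <= n)%N) :
  exists f : {C : {set poset n} | C \in unbalanced_classes n} ->
             {t : 'I_n & {D : {set poset t} | D \in bipartite_classes t}},
    bijective f.
Proof.
(* The [t] old points and the apex leave [n - t.+1] new points to reach [n] in total. *)
pose ext (t : 'I_n) (P : poset t) := extension (points P) 'I_(n - t.+1).
have card_ext (t : 'I_n) (P : poset t) : #|{: ext t P}| = n.
  by rewrite card_extension !card_ord -addSn subnKC.
pose R (C : {C : {set poset n} | C \in unbalanced_classes n})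
    (y : {t : 'I_n & {D : {set poset t} | D \in bipartite_classes t}}) :=
  exists U P, [/\ U \in val C, P \in val (tagged y) &
               order_iso (ext (tag y) P) (points U)].
apply: (bijective_of_rel (R := R)).
(* Each unbalanced class has a partner by decomposition; the removed support point makes [t < n]
   strict. *)
- move=> [C CP]; have [U UC] := iso_class_ex CP.
  have := iso_class_sub CP UC; rewrite inE => uU.
  have [A [B [bA iAB]]] := unbalanced_decomposition uU.
  have := order_iso_card iAB; rewrite card_extension card_ord => cAB.
  have tn : (#|{: subposet A}| < n)%N by rewrite -[ltnRHS]cAB ltnS leq_addr.
  have [P iP] := @poset_complete _ (subposet A) _ (erefl _).
  pose t := Ordinal tn.
  have [f _ fm] := order_isoP _ _ (order_iso_sym iP).
  have PD : P \in [set P : poset t | bipartite (points P)].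
    by rewrite inE; apply: bipartite_embedding fm bA.
  have [D DP PinD] := iso_classP PD.
  exists (Tagged
    (fun t : 'I_n => {D : {set poset t} | D \in bipartite_classes t})
    (i := t) (exist _ D DP)).
  exists U, P; split=> //=; apply: order_iso_trans iAB.
  apply: extension_iso (order_iso_sym iP) _; rewrite card_ord /=.
  by apply/eqP; rewrite -(eqn_add2l #|{: subposet A}|.+1) subnKC // addSn cAB.
(* Each bipartite class has a partner: relabel the extension of a representative by ['I_n]. *)
- move=> [t [D DP]]; have [P PD] := iso_class_ex DP.
  have := iso_class_sub DP PD; rewrite inE => bP.
  have [U iU] := poset_complete (card_ext t P).
  have UU : U \in [set U : poset n | unbalanced (points U)].
    by rewrite inE; apply: unbalanced_iso iU _; apply: unbalanced_extension.
  have [C CP UC] := iso_classP UU.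
  by exists (exist _ C CP), U, P.
(* Uniqueness of the bipartite class, by cancelling the extension. Equality of sizes comes first,
   since the type of the second component depends on [t]. *)
- move=> [C CP] [t [D DP]] [t' [D' DP']].
  case=> U [P [/= UC PD i]] [U' [P' [/= UC' PD' i']]].
  have iU := iso_class_iso CP UC UC'.
  have iP : order_iso (points P) (points P').
    apply: extension_iso_inv (order_iso_trans (order_iso_trans i iU) _).
    exact: order_iso_sym i'.
  have tt' : t = t'.
    by apply: val_inj; have := order_iso_card iP; rewrite !card_ord.
  move: D' DP' P' PD' iP {i'}; rewrite -tt' => D' DP' P' PD' iP.
  congr (existT _ t _); apply: val_inj => /=.
  exact: (iso_class_eq DP DP' PD PD' iP).
(* Uniqueness of the unbalanced class: isomorphic posets of the same size [t] have isomorphic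
   extensions. *)
- move=> [C CP] [C' CP'] [t [D DP]].
  case=> U [P [/= UC PD i]] [U' [P' [/= UC' PD' i']]].
  have iP := iso_class_iso DP PD PD'.
  have iU : order_iso (points U) (points U').
    apply: order_iso_trans (order_iso_sym i) _; apply: order_iso_trans i'.
    exact: extension_iso.
  apply: val_inj => /=.
  exact: (iso_class_eq CP CP' UC UC' iU).
Qed.
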